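(* Let $\eta=\{p_i,\rho_i\}_{i=1}^m$ be an ensemble of states on a finite-dimensional system $A$ with probabilities $p_i$, and let $n\ge1$. Then the $n$-broadcasting fidelity $g_n(\eta)$ equals the optimal value of the semidefinite program \[ \begin{aligned} \max\ &\sum_{i=1}^m\tfrac12 p_i\,\mathrm{tr}(X_i+X_i^\dagger)\\ \text{s.t. }&\begin{pmatrix}\rho_i & X_i\\ X_i^\dagger & \mathrm{tr}_{\backslash A_1}(J_{AA_1\cdots A_n}\rho_i^T)\end{pmatrix}\ge0\quad\forall i\in\{1,\dots,m\},\\ & J_{AA_1\cdots A_n}\ge0,\quad \mathrm{tr}_{A_1\cdots A_n}J_{AA_1\cdots A_n}=\mathbb{1}_A,\\ & J_{AA_1\cdots A_n}=\frac1{n!}\sum_{\pi\in S_n}W_\pi J_{AA_1\cdots A_n}W_\pi^\dagger, \end{aligned} \] with variables linear operators $X_1,\dots,X_m$ and Hermitian $J_{AA_1\cdots A_n}$, where $W_\pi$ acts on $A_1\cdots A_n$ and $\mathrm{tr}_{\backslash A_1}(J\rho_i^T)$ denotes $J(\rho_i^T\otimes\mathbb{1}_{A_1\cdots A_n})$ with all systems except $A_1$ traced out ($A_1$ identified with $A$).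
   Context: Fidelity: $F(\rho,\sigma)=\mathrm{tr}\sqrt{\sqrt{\rho}\sigma\sqrt{\rho}}$. Systems $A_1,\dots,A_n$ are copies of $A$ with a fixed orthonormal basis $\{|j\rangle\}$; transpose $T$ is taken in that basis. The $n$-broadcasting fidelity of the ensemble is \[g_n(\eta)=\sup\Big\{\sum_{i=1}^m\sum_{j=1}^n\frac1n p_iF\big(\rho_i,\mathrm{tr}_{\backslash A_j}\Lambda_{A\to A_1\cdots A_n}(\rho_i)\big):\ \Lambda\text{ a quantum channel}\Big\},\] where $\mathrm{tr}_{\backslash A_j}$ traces out all outputs except $A_j$. For $\pi\in S_n$, $W_\pi|j_1,\dots,j_n\rangle=|j_{\pi^{-1}(1)},\dots,j_{\pi^{-1}(n)}\rangle$ on $A_1\cdots A_n$. *)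

(* Defs.v *)
From HB Require Import structures.
From mathcomp Require Import all_boot all_order all_algebra.
From mathcomp Require Import fingroup perm.
From mathcomp Require Import boolp classical_sets reals.
From mathcomp Require Import complex.
From Stdlib Require Import ClassicalEpsilon.

Set Implicit Arguments.
Unset Strict Implicit.
Unset Printing Implicit Defensive.

Import Order.TTheory GRing.Theory Num.Theory.
Local Open Scope ring_scope.

Section QDefs.
Variable R : realType.
Local Notation C := (R[i]).

(* Operators on the Hilbert space with orthonormal basis indexed by the
   finite type T, written as matrices in that basis. *)
Definition op (T : finType) := 'M[C]_#|T|.

Definition ent (T : finType) (M : op T) (x y : T) : C :=
  M (enum_rank x) (enum_rank y).

Definition mkop (T : finType) (f : T -> T -> C) : op T :=
  \matrix_(i, j) f (enum_val i) (enum_val j).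

Definition adj (k l : nat) (M : 'M[C]_(k, l)) : 'M[C]_(l, k) :=
  (map_mx Num.conj M)^T.

Definition hermitian (k : nat) (M : 'M[C]_k) : Prop := adj M = M.

Definition psd (k : nat) (M : 'M[C]_k) : Prop :=
  hermitian M /\ forall v : 'cV[C]_k, 0 <= ((adj v) *m M *m v) 0 0.

Definition is_state (T : finType) (rho : op T) : Prop :=
  psd rho /\ \tr rho = 1.

(* the positive semidefinite square root (chosen classically; it is unique
   when M is psd) *)
Definition msqrt (k : nat) (M : 'M[C]_k) : 'M[C]_k :=
  epsilon (inhabits 0) (fun S => psd S /\ S *m S = M).

Definition fidelity (k : nat) (rho sigma : 'M[C]_k) : R :=
  complex.Re (\tr (msqrt (msqrt rho *m sigma *m msqrt rho))).

Definition lin_map (TA TB : finType) (L : op TA -> op TB) : Prop :=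
  forall (a : C) (X Y : op TA), L (a *: X + Y) = a *: L X + L Y.

(* the map id_k (x) L on operators of C^k (x) H_A *)
Definition ampl (k : nat) (TA TB : finType) (L : op TA -> op TB)
  (X : op ('I_k * TA)%type) : op ('I_k * TB)%type :=
  mkop (fun (x y : ('I_k * TB)%type) =>
          ent (L (mkop (fun u v => ent X (x.1, u) (y.1, v)))) x.2 y.2).

Definition positive_map (TA TB : finType) (L : op TA -> op TB) : Prop :=
  forall X, psd X -> psd (L X).

Definition completely_positive (TA TB : finType) (L : op TA -> op TB) : Prop :=
  forall k : nat, positive_map (@ampl k TA TB L).

Definition trace_preserving (TA TB : finType) (L : op TA -> op TB) : Prop :=
  forall X, \tr (L X) = \tr X.

Definition channel (TA TB : finType) (L : op TA -> op TB) : Prop :=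
  [/\ lin_map L, completely_positive L & trace_preserving L].

(* ---- n copies A_1 ... A_n of A (basis index type I) ---- *)
Definition multi (I : finType) (n : nat) := {ffun 'I_n -> I}.

Definition upd (I : finType) (n : nat) (f : multi I n) (j : 'I_n) (b : I)
  : multi I n := [ffun k => if k == j then b else f k].

Definition ptr_keep (I : finType) (n : nat) (j : 'I_n) (M : op (multi I n))
  : op I :=
  mkop (fun a b => \sum_(f : multi I n | f j == a) ent M f (upd f j b)).

(* on A A_1...A_n: tr_{\A_1}, keeping only the system A_1 (the output of
   index 0 : 'I_n; n >= 1 in the theorem, for n = 0 this is just 0) *)
Definition ptr_keep1 (I : finType) (n : nat) (M : op (I * multi I n)%type)
  : op I :=
  if (insub 0%N : option 'I_n) is Some j1 then
    mkop (fun a b => \sum_(x : I) \sum_(f : multi I n | f j1 == a)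
                        ent M (x, f) (x, upd f j1 b))
  else 0.

Definition ptr_out (I : finType) (n : nat) (M : op (I * multi I n)%type)
  : op I :=
  mkop (fun a b => \sum_(f : multi I n) ent M (a, f) (b, f)).

Definition tens_id (I : finType) (n : nat) (rho : op I) : op (I * multi I n)%type :=
  mkop (fun (x y : (I * multi I n)%type) => ent rho x.1 y.1 * (x.2 == y.2)%:R).

(* 1_A (x) W_pi, where W_pi |j_1..j_n> = |j_{pi^-1(1)} .. j_{pi^-1(n)}> *)
Definition Wperm (I : finType) (n : nat) (pi : 'S_n) : op (I * multi I n)%type :=
  mkop (fun (x y : (I * multi I n)%type) => ((x.1 == y.1) &&
                    (x.2 == [ffun k => y.2 ((pi^-1)%g k)]))%:R).

Definition sym_invariant (I : finType) (n : nat) (J : op (I * multi I n)%type)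
  : Prop :=
  J = (n`!%:R)^-1 *: \sum_(pi : 'S_n) (Wperm I pi *m J *m adj (Wperm I pi)).

Definition broadcast_values (I : finType) (m n : nat) (p : 'I_m -> R)
  (rho : 'I_m -> op I) : set R :=
  [set v | exists L : op I -> op (multi I n), channel L /\
     v = \sum_(i < m) \sum_(j < n) (n%:R)^-1 * p i *
           fidelity (rho i) (ptr_keep j (L (rho i)))].

Definition g_n (I : finType) (m n : nat) (p : 'I_m -> R) (rho : 'I_m -> op I) : R :=
  sup (broadcast_values n p rho).

Definition sdp_feasible (I : finType) (m n : nat) (rho : 'I_m -> op I)
  (X : 'I_m -> op I) (J : op (I * multi I n)%type) : Prop :=
  [/\ forall i, psd (block_mx (rho i) (X i) (adj (X i))
                      (ptr_keep1 (J *m tens_id n (rho i)^T))),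
      hermitian J, psd J,
      ptr_out J = 1%:M
    & sym_invariant J].

Definition sdp_objective (I : finType) (m : nat) (p : 'I_m -> R)
  (X : 'I_m -> op I) : R :=
  complex.Re (\sum_(i < m) (2%:R)^-1 * ((p i)%:C)%C * \tr (X i + adj (X i))).

Definition sdp_values (I : finType) (m n : nat) (p : 'I_m -> R)
  (rho : 'I_m -> op I) : set R :=
  [set v | exists (X : 'I_m -> op I) (J : op (I * multi I n)%type),
     sdp_feasible rho X J /\ v = sdp_objective p X].

Definition sdp_value (I : finType) (m n : nat) (p : 'I_m -> R)
  (rho : 'I_m -> op I) : R := sup (sdp_values n p rho).

End QDefs.

(* Main.v *)
(* Fidelity is itself the value of the semidefinite program maximising [Re tr X]
   over positive block matrices [[rho, X], [X^dagger, sigma]]: writing the block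
   matrix as a Gram matrix and using polar decompositions gives the upper bound,
   and [X = sqrt rho K^dagger sqrt sigma], with [K] the polar factor of
   [sqrt sigma sqrt rho], attains it.  The Choi correspondence turns channels into
   feasible [J].  Averaging the optimal [X_(i,j)] over the outputs [j] and the Choi
   matrix over [S_n] sends a channel to a feasible point with at least the same
   value; conversely the channel of a symmetric [J] has equal marginals, and the
   upper bound on [Re tr X_i] applies to each of them.  Thus the two sets of values
   dominate each other and have the same supremum. *)

Require Import Defs.
From HB Require Import structures.
From mathcomp Require Import all_boot all_order all_algebra.
From mathcomp Require Import fingroup perm.
From mathcomp Require Import boolp classical_sets reals.
From mathcomp Require Import complex lra.
From Stdlib Require Import ClassicalEpsilon.

Set Implicit Arguments.
Unset Strict Implicit.
Unset Printing Implicit Defensive.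

Import Order.TTheory GRing.Theory Num.Theory.
Local Open Scope ring_scope.

Lemma hermitian_mx_spectral (C : numClosedFieldType) k (M : 'M[C]_k) :
  (map_mx Num.conj M)^T = M ->
  exists (Q : 'M[C]_k) (d : 'rV[C]_k),
    [/\ Q *m (map_mx Num.conj Q)^T = 1%:M, (map_mx Num.conj Q)^T *m Q = 1%:M &
        M = (map_mx Num.conj Q)^T *m diag_mx d *m Q].
Proof.
move=> hM; exists (spectralmx M), (spectral_diag M).
have QQ : spectralmx M *m (map_mx Num.conj (spectralmx M))^T = 1%:M.
  by rewrite map_trmx; apply/unitarymxP/spectral_unitarymx.
split=> //; first exact: mulmx1C.
have : M \is normalmx by apply/normalmxP; rewrite -map_trmx hM.
move=> /orthomx_spectralP; rewrite invmx_unitary ?spectral_unitarymx //.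
by rewrite -map_trmx.
Qed.

(** * Positive matrices and the fidelity program *)

Section Adjoint.
Variable R : realType.
Local Notation C := (R[i]).
Local Notation hermitian := Defs.hermitian.

Lemma adjE k l (M : 'M[C]_(k, l)) i j : adj M i j = (M j i)^*.
Proof. by rewrite !mxE. Qed.

Lemma adjK k l (M : 'M[C]_(k, l)) : adj (adj M) = M.
Proof. by apply/matrixP => i j; rewrite !adjE conjCK. Qed.

Lemma adjM k l q (M : 'M[C]_(k, l)) (N : 'M[C]_(l, q)) :
  adj (M *m N) = adj N *m adj M.
Proof. by rewrite /adj map_mxM trmx_mul. Qed.

Lemma adjD k l (M N : 'M[C]_(k, l)) : adj (M + N) = adj M + adj N.
Proof. by rewrite /adj map_mxD linearD. Qed.

Lemma adjB k l (M N : 'M[C]_(k, l)) : adj (M - N) = adj M - adj N.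
Proof. by rewrite /adj map_mxB linearB. Qed.

Lemma adj_scale k l a (M : 'M[C]_(k, l)) : adj (a *: M) = a^* *: adj M.
Proof. by rewrite /adj map_mxZ linearZ. Qed.

Lemma adj0 k l : adj (0 : 'M[C]_(k, l)) = 0.
Proof. by rewrite /adj map_mx0 trmx0. Qed.

Lemma adj1 k : adj (1%:M : 'M[C]_k) = 1%:M.
Proof. by rewrite /adj map_mx1 trmx1. Qed.

Lemma adj_sum k l (J : finType) (M : J -> 'M[C]_(k, l)) :
  adj (\sum_j M j) = \sum_j adj (M j).
Proof. by rewrite (big_morph _ (@adjD k l) (@adj0 k l)). Qed.

Lemma adj_row k l q (M : 'M[C]_(k, l)) (N : 'M[C]_(k, q)) :
  adj (row_mx M N) = col_mx (adj M) (adj N).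
Proof. by rewrite /adj map_row_mx tr_row_mx. Qed.

Lemma adj_diag k (d : 'rV[C]_k) : adj (diag_mx d) = diag_mx (map_mx Num.conj d).
Proof. by rewrite /adj map_diag_mx tr_diag_mx. Qed.

Lemma tr_adj k (M : 'M[C]_k) : \tr (adj M) = (\tr M)^*.
Proof. by rewrite /mxtrace rmorph_sum; apply: eq_bigr => i _; rewrite adjE. Qed.

Lemma cRe_conj (z : C) : @complex.Re R z^* = complex.Re z.
Proof. by case: z. Qed.

Lemma cReD (z w : C) : @complex.Re R (z + w) = complex.Re z + complex.Re w.
Proof. by case: z; case: w. Qed.

Lemma tr_subE k (M N : 'M[C]_k) : \tr (M - N) = \tr M - \tr N.
Proof. exact: raddfB. Qed.

Lemma tr_mulB k (N A B : 'M[C]_k) :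
  \tr (N *m (A - B)) = \tr (N *m A) - \tr (N *m B).
Proof. by rewrite mulmxBr tr_subE. Qed.

Lemma cRe_ge0 (z : C) : 0 <= z -> 0 <= complex.Re z.
Proof. by case: z => a b; rewrite lecE => /andP[]. Qed.

Lemma tr_gramE k l (B : 'M[C]_(l, k)) :
  \tr (adj B *m B) = \sum_j \sum_i `|B i j| ^+ 2.
Proof.
rewrite /mxtrace; apply: eq_bigr => j _; rewrite mxE.
by apply: eq_bigr => i _; rewrite adjE mulrC -normCK.
Qed.

Lemma tr_gram_ge0 k l (B : 'M[C]_(l, k)) : 0 <= \tr (adj B *m B).
Proof.
by rewrite tr_gramE; do 2![apply: sumr_ge0 => ? _]; rewrite exprn_ge0.
Qed.

Lemma gram_eq0 k l (B : 'M[C]_(l, k)) : adj B *m B = 0 -> B = 0.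
Proof.
move=> B0; have := tr_gramE B; rewrite B0 mxtrace0 => /esym/eqP.
rewrite psumr_eq0 => [/allP h|j _]; last by apply: sumr_ge0 => i _; rewrite exprn_ge0.
apply/matrixP => i j; have := h j (mem_index_enum j); rewrite implyTb.
rewrite psumr_eq0 => [/allP/(_ i (mem_index_enum i))|? _]; last by rewrite exprn_ge0.
by rewrite implyTb expf_eq0 normr_eq0 mxE => /eqP.
Qed.

Lemma psd_gram k l (B : 'M[C]_(l, k)) : psd (adj B *m B).
Proof.
split=> [|v]; first by rewrite /hermitian adjM adjK.
have -> : adj v *m (adj B *m B) *m v = adj (B *m v) *m (B *m v).
  by rewrite adjM !mulmxA.
rewrite -trace_mx11; exact: tr_gram_ge0.
Qed.

Lemma psdD k (M N : 'M[C]_k) : psd M -> psd N -> psd (M + N).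
Proof.
move=> [hM pM] [hN pN]; split; first by rewrite /hermitian adjD hM hN.
by move=> v; rewrite mulmxDr mulmxDl mxE addr_ge0.
Qed.

Lemma psd0 k : psd (0 : 'M[C]_k).
Proof. by split=> [|v]; rewrite /hermitian ?adj0 // mulmx0 mul0mx mxE. Qed.

Lemma psdZ k (a : C) (M : 'M[C]_k) : 0 <= a -> psd M -> psd (a *: M).
Proof.
move=> a0 [hM pM]; split=> [|v]; last by rewrite -scalemxAr -scalemxAl mxE mulr_ge0.
by rewrite /hermitian adj_scale hM geC0_conj.
Qed.

Lemma psd_sum k (J : finType) (P : pred J) (M : J -> 'M[C]_k) :
  (forall j, P j -> psd (M j)) -> psd (\sum_(j | P j) M j).
Proof. by move=> h; apply: big_ind => [|M1 M2|j Pj]; [exact: psd0|exact: psdD|exact: h]. Qed.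

Lemma psd_congr k l (A : 'M[C]_(k, l)) (M : 'M[C]_k) :
  psd M -> psd (adj A *m M *m A).
Proof.
move=> [hM pM]; split=> [|v]; first by rewrite /hermitian !adjM adjK hM mulmxA.
by have := pM (A *m v); rewrite adjM !mulmxA.
Qed.

Lemma hermitian_spectral k (M : 'M[C]_k) : hermitian M ->
  exists (Q : 'M[C]_k) (d : 'rV[C]_k),
    [/\ Q *m adj Q = 1%:M, adj Q *m Q = 1%:M & M = adj Q *m diag_mx d *m Q].
Proof. exact: hermitian_mx_spectral. Qed.

Lemma psd_has_sqrt k (M : 'M[C]_k) :
  psd M -> exists S : 'M[C]_k, psd S /\ S *m S = M.
Proof.
move=> [hM pM]; have [Q [d [QQ QQ' eM]]] := hermitian_spectral hM.
have d_ge0 i : 0 <= d 0 i.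
  (* Positivity tested on the [i]-th eigenvector, column [i] of [adj Q], reads off the
     eigenvalue. *)
  have := pM (adj Q *m delta_mx i 0); rewrite eM adjM adjK !mulmxA.
  rewrite -[_ *m Q *m adj Q]mulmxA QQ mulmx1 -[_ *m Q *m adj Q]mulmxA QQ mulmx1.
  rewrite -colE mxE; congr (0 <= _).
  rewrite mul_mx_diag mxE adjE mxE !eqxx /= conjC1 mul1r //.
pose sq q := diag_mx (map_mx sqrtC q) : 'M[C]_k.
have sq_sq (q : 'rV[C]_k) : sq q *m sq q = diag_mx q.
  apply/matrixP => i j; rewrite mul_mx_diag !mxE.
  by case: eqP => [->|_]; rewrite ?mulr1n ?mulr0n ?mul0r // -expr2 sqrtCK.
have adj_sq (q : 'rV[C]_k) : (forall i, 0 <= q 0 i) -> adj (sq q) = sq q.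
  move=> q0; rewrite adj_diag; congr diag_mx; apply/rowP => i.
  by rewrite !mxE geC0_conj // sqrtC_ge0.
exists (adj Q *m sq d *m Q); split; last first.
  rewrite eM !mulmxA -[_ *m Q *m adj Q]mulmxA QQ mulmx1.
  by rewrite -[_ *m sq d *m sq d]mulmxA sq_sq.
(* Positivity of the root comes from writing it as a Gram matrix, with the fourth roots of the
   eigenvalues on the diagonal. *)
have -> : adj Q *m sq d *m Q =
    adj (sq (map_mx sqrtC d) *m Q) *m (sq (map_mx sqrtC d) *m Q).
  rewrite adjM adj_sq => [|i]; last by rewrite mxE sqrtC_ge0.
  by rewrite !mulmxA -[_ *m sq _ *m sq _]mulmxA sq_sq.
exact: psd_gram.
Qed.

Lemma hermitian_pinv k (N : 'M[C]_k) : hermitian N ->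
  exists G : 'M[C]_k, [/\ hermitian G, N *m G *m N = N & G *m N = N *m G].
Proof.
move=> hN; have [Q [d [QQ QQ' eN]]] := hermitian_spectral hN.
(* Since [0^-1 = 0], entrywise inversion inverts the nonzero eigenvalues and keeps the kernel, which
   yields the Moore-Penrose inverse. *)
pose e := map_mx GRing.inv d.
have mulQ (A B : 'M[C]_k) : adj Q *m A *m Q *m (adj Q *m B *m Q)
    = adj Q *m (A *m B) *m Q.
  by rewrite !mulmxA -[_ *m Q *m adj Q]mulmxA QQ mulmx1.
have d_real : map_mx Num.conj d = d.
  have h : diag_mx d = Q *m N *m adj Q.
    by rewrite eN !mulmxA QQ mul1mx -mulmxA QQ mulmx1.
  apply/rowP => i.
  have := congr1 (@adj R k k) h; rewrite !adjM adjK hN mulmxA -h adj_diag.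
  by move=> /matrixP/(_ i i); rewrite !mxE eqxx !mulr1n.
exists (adj Q *m diag_mx e *m Q); split.
- rewrite /hermitian !adjM adjK adj_diag mulmxA; congr (_ *m diag_mx _ *m _).
  apply/rowP => i; rewrite !mxE fmorphV; congr (_^-1).
  by have /rowP/(_ i) := d_real; rewrite mxE.
- rewrite eN !mulQ; congr (_ *m _ *m _); apply/matrixP => i j.
  rewrite !mul_mx_diag !mxE; case: eqP => [->|_]; rewrite ?mulr1n ?mulr0n ?mul0r //.
  by have [->|d0] := eqVneq (d 0 j) 0; rewrite ?mulr0 // mulfV // mul1r.
- by rewrite eN !mulQ diag_mxC.
Qed.

(** With square roots [S] and [T], cyclicity makes the trace that of the Gram matrix of [S *m T]. *)
Lemma tr_psd_mul_ge0 k (M N : 'M[C]_k) : psd M -> psd N -> 0 <= \tr (M *m N).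
Proof.
move=> /psd_has_sqrt[S [[hS _] <-]] /psd_has_sqrt[T [[hT _] <-]].
have -> : \tr (S *m S *m (T *m T)) = \tr (adj (S *m T) *m (S *m T)).
  by rewrite adjM hS hT mulmxA mxtrace_mulC !mulmxA.
exact: tr_gram_ge0.
Qed.

(* The partial isometry [A N^+] is a contraction that acts
   isometrically on the range of [N]. *)
Lemma polar k l (A : 'M[C]_(l, k)) (N : 'M[C]_k) :
  hermitian N -> adj A *m A = N *m N ->
  exists K : 'M[C]_(l, k),
    [/\ A = K *m N, psd (1%:M - adj K *m K) & adj K *m K *m N = N].
Proof.
move=> hN AA; have [G [hG NGN GN]] := hermitian_pinv hN.
(* [G *m N] is the orthogonal projection onto the range of [N]. The three claims below follow from
   this, the first because the Gram matrix of [A *m (1%:M - G *m N)] vanishes. *)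
have KK : adj (A *m G) *m (A *m G) = G *m N.
  rewrite adjM hG mulmxA -[_ *m adj A *m A]mulmxA AA.
  by rewrite -mulmxA -[N *m N *m G]mulmxA -GN [N *m (G *m N)]mulmxA NGN.
exists (A *m G); rewrite KK; split.
- apply/eqP; rewrite -subr_eq0; apply/eqP/gram_eq0.
  have -> : A - A *m G *m N = A *m (1%:M - G *m N) by rewrite mulmxBr mulmx1 mulmxA.
  rewrite adjM mulmxA -[_ *m adj A *m A]mulmxA AA -!mulmxA [N *m (_ - _)]mulmxBr.
  by rewrite mulmx1 [N *m (G *m N)]mulmxA NGN subrr !mulmx0.
- have -> : 1%:M - G *m N = adj (1%:M - G *m N) *m (1%:M - G *m N).
    rewrite adjB adj1 adjM hG hN -GN mulmxBl mul1mx mulmxBr mulmx1.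
    rewrite -[G *m N *m _]mulmxA [N *m (G *m N)]mulmxA NGN subrr subr0 //.
  exact: psd_gram.
- by rewrite GN NGN.
Qed.

(** A weighted Cauchy-Schwarz inequality: expanding [0 <= \tr (N *m (adj (A - B) *m (A - B)))]
    bounds twice the left side by the two diagonal terms, and each of these is at most [\tr N] for a
    contraction. *)
Lemma tr_contraction_le k l (N : 'M[C]_k) (A B : 'M[C]_(l, k)) : psd N ->
  psd (1%:M - adj A *m A) -> psd (1%:M - adj B *m B) ->
  complex.Re (\tr (N *m (adj A *m B))) <= complex.Re (\tr N).
Proof.
move=> pN Ac Bc.
have h0 := tr_psd_mul_ge0 pN (psd_gram (A - B)).
have h1 := tr_psd_mul_ge0 pN Ac; have h2 := tr_psd_mul_ge0 pN Bc.
rewrite tr_mulB mulmx1 in h1; rewrite tr_mulB mulmx1 in h2.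
have BA : \tr (N *m (adj B *m A)) = (\tr (N *m (adj A *m B)))^*.
  by rewrite -tr_adj !adjM adjK pN.1 mxtrace_mulC.
have e0 : \tr (N *m (adj (A - B) *m (A - B))) =
    \tr (N *m (adj A *m A)) - \tr (N *m (adj A *m B))
    - ((\tr (N *m (adj A *m B)))^* - \tr (N *m (adj B *m B))).
  rewrite -BA adjB mulmxBl (mulmxBr (adj A)) (mulmxBr (adj B)).
  move: (adj A *m A) (adj A *m B) (adj B *m A) (adj B *m B) => a b c d.
  by rewrite !tr_mulB.
rewrite e0 in h0; have := addr_ge0 h0 (addr_ge0 h1 h2).
move: (\tr _) (\tr _) (\tr _) (\tr N) => x z y u /cRe_ge0.
by case: x z y u => [? ?] [? ?] [? ?] [? ?] /=; lra.
Qed.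

Lemma msqrtP k (M : 'M[C]_k) : psd M -> psd (msqrt M) /\ msqrt M *m msqrt M = M.
Proof.
move=> /psd_has_sqrt ex.
exact: (epsilon_spec (inhabits 0) (fun S : 'M[C]_k => psd S /\ S *m S = M)).
Qed.

(** A root of the block matrix, cut into column blocks [P] and [Q], gives [X = adj P *m Q]. With
    [P = K1 *m s], [Q = K2 *m t] and [t *m s = K3 *m N], cyclicity turns [\tr X] into
    [\tr (N *m (adj K1 *m (K2 *m K3)))], a trace of [N] against contractions. *)
Lemma fidelity_ge k (rho sigma X : 'M[C]_k) :
  psd (block_mx rho X (adj X) sigma) ->
  complex.Re (\tr X) <= fidelity rho sigma.
Proof.
move=> /psd_has_sqrt[G [[hG _]]].
rewrite -{1}hG -(hsubmxK G); set P := lsubmx G; set Q := rsubmx G.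
rewrite adj_row mul_col_row => /eq_block_mx[eP eX _ eQ].
have prho : psd rho by rewrite -eP; exact: psd_gram.
have psigma : psd sigma by rewrite -eQ; exact: psd_gram.
have [[hs _] ss] := msqrtP prho; have [[ht _] tt] := msqrtP psigma.
rewrite /fidelity; set s := msqrt rho in hs ss *; set t := msqrt sigma in ht tt.
have eZ : adj (t *m s) *m (t *m s) = s *m sigma *m s.
  by rewrite adjM hs ht -tt !mulmxA.
have /msqrtP[pN NN] : psd (s *m sigma *m s) by rewrite -eZ; exact: psd_gram.
set N := msqrt _ in pN NN *; have hN := pN.1.
have [K1 [eP1 K1c _]] := polar hs (etrans eP (esym ss)).
have [K2 [eQ2 K2c _]] := polar ht (etrans eQ (esym tt)).
have [K3 [eZ3 K3c _]] := polar hN (etrans eZ (esym NN)).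
set L := K2 *m K3.
have Lc : psd (1%:M - adj L *m L).
  (* A product of contractions is a contraction: the defect of [L] is that of [K3] plus the defect
     of [K2] conjugated by [K3]. *)
  have -> : 1%:M - adj L *m L =
      1%:M - adj K3 *m K3 + adj K3 *m (1%:M - adj K2 *m K2) *m K3.
    by rewrite mulmxBr mulmxBl mulmx1 addrA subrK /L adjM !mulmxA.
  exact: (psdD K3c (psd_congr K3 K2c)).
suff -> : \tr X = \tr (N *m (adj K1 *m L)) by exact: tr_contraction_le.
rewrite -eX eP1 eQ2 adjM hs -mulmxA mxtrace_mulC -!mulmxA eZ3.
by rewrite [RHS]mxtrace_mulC /L !mulmxA.
Qed.

Lemma fidelity_attained k (rho sigma : 'M[C]_k) : psd rho -> psd sigma ->
  exists2 X : 'M[C]_k, psd (block_mx rho X (adj X) sigma) &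
    complex.Re (\tr X) = fidelity rho sigma.
Proof.
move=> prho psigma.
have [[hs _] ss] := msqrtP prho; have [[ht _] tt] := msqrtP psigma.
rewrite /fidelity; set s := msqrt rho in hs ss *; set t := msqrt sigma in ht tt.
have eZ : adj (t *m s) *m (t *m s) = s *m sigma *m s.
  by rewrite adjM hs ht -tt !mulmxA.
have /msqrtP[[hN _] NN] : psd (s *m sigma *m s) by rewrite -eZ; exact: psd_gram.
set N := msqrt _ in hN NN *.
have [K [eK Kc KN]] := polar hN (etrans eZ (esym NN)).
(* By cyclicity the trace of this witness is that of [adj K *m K *m N], which is [N]. *)
exists (s *m adj K *m t); last first.
  by rewrite -mulmxA mxtrace_mulC -mulmxA eK mulmxA KN.
(* The Gram matrix of the row [(K *m s, t)] has the right blocks except the upper left one; the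
   second summand adds the missing [s *m (1%:M - adj K *m K) *m s] there. *)
have -> : block_mx rho (s *m adj K *m t) (adj (s *m adj K *m t)) sigma =
   adj (row_mx (K *m s) t) *m row_mx (K *m s) t +
   adj (row_mx s 0) *m (1%:M - adj K *m K) *m row_mx s (0 : 'M_k).
  rewrite !adj_row mul_col_row -[_ *m (_ - _) *m _]mulmxA mul_mx_row mul_col_row add_block_mx.
  rewrite !adjM adjK hs ht adj0 !(mulmx0, mul0mx, addr0) tt mulmxA.
  congr block_mx; rewrite -?mulmxA //.
  by rewrite mulmxBl mulmxBr mul1mx ss !mulmxA addrC subrK.
by apply: psdD; [exact: psd_gram|exact: psd_congr].
Qed.
End Adjoint.

(** * Operators through their entries in the basis *)

Section Entries.
Variable R : realType.
Local Notation C := (R[i]).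
Implicit Types T S : finType.

Lemma ent_mkop T (f : T -> T -> C) x y : ent (mkop f) x y = f x y.
Proof. by rewrite /ent mxE !enum_rankK. Qed.

Lemma op_ext T (M N : op R T) : (forall x y, ent M x y = ent N x y) -> M = N.
Proof.
move=> h; apply/matrixP => i j.
by have := h (enum_val i) (enum_val j); rewrite /ent !enum_valK.
Qed.

Lemma entD T (M N : op R T) x y : ent (M + N) x y = ent M x y + ent N x y.
Proof. exact: mxE. Qed.

Lemma entZ T a (M : op R T) x y : ent (a *: M) x y = a * ent M x y.
Proof. exact: mxE. Qed.

Lemma ent_sum T (J : finType) (P : pred J) (M : J -> op R T) x y :
  ent (\sum_(j | P j) M j) x y = \sum_(j | P j) ent (M j) x y.
Proof. exact: summxE. Qed.

Lemma ent_adj T (M : op R T) x y : ent (adj M) x y = (ent M y x)^*.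
Proof. exact: adjE. Qed.

Lemma ent_tr T (M : op R T) x y : ent M^T x y = ent M y x.
Proof. exact: mxE. Qed.

Lemma ent1 T x y : ent (1%:M : op R T) x y = (x == y)%:R.
Proof. by rewrite /ent mxE (inj_eq enum_rank_inj). Qed.

Lemma sum_enum_rank T (F : 'I_#|T| -> C) : \sum_i F i = \sum_(x : T) F (enum_rank x).
Proof.
rewrite (reindex (@enum_rank T)) //=; exists enum_val => x _.
  exact: enum_rankK.
exact: enum_valK.
Qed.

Lemma ent_mul T (M N : op R T) x y :
  ent (M *m N) x y = \sum_z ent M x z * ent N z y.
Proof. by rewrite /ent mxE sum_enum_rank. Qed.

Lemma tr_ent T (M : op R T) : \tr M = \sum_x ent M x x.
Proof. by rewrite /mxtrace sum_enum_rank. Qed.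

Lemma sum_delta T (F : T -> C) c : \sum_x (x == c)%:R * F x = F c.
Proof.
rewrite (bigD1 c) //= eqxx mul1r big1 ?addr0 // => x /negbTE ->.
by rewrite mul0r.
Qed.

Lemma psd_gram_ent T S (M : op R T) (B : S -> T -> C) :
  (forall x y, ent M x y = \sum_r (B r x)^* * B r y) -> psd M.
Proof.
move=> h; pose B' : 'M[C]_(#|S|, #|T|) := \matrix_(i, j) B (enum_val i) (enum_val j).
suff -> : M = adj B' *m B' by exact: psd_gram.
apply: op_ext => x y; rewrite h /ent mxE sum_enum_rank.
by apply: eq_bigr => r _; rewrite adjE !mxE !enum_rankK.
Qed.

Lemma psd_ent_gram T (M : op R T) : psd M ->
  exists B : T -> T -> C, forall x y, ent M x y = \sum_r (B r x)^* * B r y.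
Proof.
move=> /psd_has_sqrt[S [[hS _] <-]]; exists (@ent R T S) => x y.
by rewrite -{1}hS ent_mul; apply: eq_bigr => r _; rewrite ent_adj.
Qed.

(** The Gram vectors are composed with [phi], which may be any map: this covers relabelling of the
    basis, restriction to a block, and an added one-dimensional factor. *)
Lemma psd_pullback T S (phi : S -> T) (M : op R T) :
  psd M -> psd (mkop (fun x y => ent M (phi x) (phi y))).
Proof.
move=> /psd_ent_gram[B hB]; apply: (psd_gram_ent (B := fun r x => B r (phi x))).
by move=> x y; rewrite ent_mkop hB.
Qed.

End Entries.

(** * Choi correspondence *)

Section Choi.
Variable R : realType.
Local Notation C := (R[i]).
Variables TA TB : finType.
Implicit Types (L : op R TA -> op R TB) (J : op R (TA * TB)%type).

(** The partial trace over the input of [J] times [Y^T] tensored with the identity, with the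
    transpose absorbed into the index order of [Y]. *)
Definition choi_map J (Y : op R TA) : op R TB :=
  mkop (fun f g => \sum_x \sum_z ent J (x, f) (z, g) * ent Y x z).

Definition mat_unit (a b : TA) : op R TA :=
  mkop (fun u v => ((u == a) && (v == b))%:R).

Definition choi L : op R (TA * TB)%type :=
  mkop (fun p q => ent (L (mat_unit p.1 q.1)) p.2 q.2).

Lemma lin_map_sum L (T : finType) (c : T -> C) (E : T -> op R TA) : lin_map L ->
  L (\sum_x c x *: E x) = \sum_x c x *: L (E x).
Proof.
move=> linL.
have L0 : L 0 = 0.
  have := linL 1 0 0; rewrite !scale1r addr0 => /(congr1 (fun Z => Z - L 0)).
  by rewrite subrr addrK.
pose P Y Z := L Y = Z.
apply: (@big_ind2 _ _ P) => [//|Y1 Z1 Y2 Z2 h1 h2|x _].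
  by have := linL 1 Y1 Y2; rewrite !scale1r /P => ->; rewrite h1 h2.
by have := linL (c x) (E x) 0; rewrite !addr0 L0 addr0.
Qed.

Lemma mat_unit_sum (Y : op R TA) :
  Y = \sum_p ent Y p.1 p.2 *: mat_unit p.1 p.2.
Proof.
apply: op_ext => x y; rewrite ent_sum (bigD1 (x, y)) //= big1 => [|[a b] ne].
  by rewrite addr0 entZ ent_mkop !eqxx mulr1.
rewrite entZ ent_mkop /=; case: andP => [[/eqP ea /eqP eb]|_]; last by rewrite mulr0.
by rewrite ea eb eqxx in ne.
Qed.

Lemma choi_mapK L (Y : op R TA) : lin_map L -> choi_map (choi L) Y = L Y.
Proof.
move=> linL; rewrite [in RHS](mat_unit_sum Y) (lin_map_sum _ _ linL).
apply: op_ext => f g; rewrite ent_mkop ent_sum pair_bigA /=.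
by apply: eq_bigr => p _; rewrite entZ ent_mkop mulrC.
Qed.

(** The Choi matrix is the ampliation of [L] applied to the unnormalised maximally entangled
    operator [Om]. Ampliations act on ['I_k], so the reference copy of [TA] is indexed through
    [enum_rank]. *)
Lemma psd_choi L : completely_positive L -> psd (choi L).
Proof.
move=> cpL.
pose Om : op R ('I_#|TA| * TA)%type :=
  mkop (fun p q => ((p.1 == enum_rank p.2) && (q.1 == enum_rank q.2))%:R).
have pOm : psd Om.
  pose B (r : unit) (p : 'I_#|TA| * TA) : C := (p.1 == enum_rank p.2)%:R.
  apply: (psd_gram_ent (B := B)) => p q; rewrite ent_mkop.
  by rewrite (big_pred1 tt) => [|[]]; rewrite // /B conjC_nat -natrM mulnb.
have := psd_pullback (fun p : TA * TB => (enum_rank p.1, p.2)) (cpL _ _ pOm).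
congr psd; apply: op_ext => p q; rewrite !ent_mkop /=.
congr (ent (L _) _ _); apply: op_ext => u v; rewrite !ent_mkop /=.
by rewrite !(inj_eq enum_rank_inj) [p.1 == u]eq_sym [q.1 == v]eq_sym.
Qed.

Lemma positive_of_cp L : completely_positive L -> positive_map L.
Proof.
move=> cpL Y pY.
have pX := psd_pullback (fun p : 'I_1 * TA => p.2) pY.
have := psd_pullback (fun f : TB => (ord0 : 'I_1, f)) (cpL _ _ pX).
congr psd; apply: op_ext => f g; rewrite !ent_mkop /=.
by congr (ent (L _) _ _); apply: op_ext => u v; rewrite !ent_mkop.
Qed.

Lemma choi_map_channel J : psd J ->
  (forall a b, \sum_f ent J (a, f) (b, f) = (a == b)%:R) -> channel (choi_map J).
Proof.
move=> pJ trJ; split.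
- move=> a Y Z; apply: op_ext => f g; rewrite entD entZ !ent_mkop mulr_sumr -big_split.
  apply: eq_bigr => x _; rewrite mulr_sumr -big_split.
  by apply: eq_bigr => z _; rewrite /= entD entZ mulrDr mulrCA.
- move=> k X /psd_ent_gram[A hA]; have [B hB] := psd_ent_gram pJ.
  (* Gram vectors of the output, indexed by pairs of Gram vectors of [J] and of [X]: each [B r] acts
     as a Kraus operator on each [A s]. *)
  pose D (rs : (TA * TB) * ('I_k * TA)) (p : 'I_k * TB) :=
    \sum_x B rs.1 (x, p.2) * A rs.2 (p.1, x).
  apply: (psd_gram_ent (B := D)) => -[i f] [j g].
  rewrite ent_mkop /= [LHS]ent_mkop.
  pose F x z r s := ((B r (x, f))^* * B r (z, g)) * ((A s (i, x))^* * A s (j, z)).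
  transitivity (\sum_x \sum_z \sum_r \sum_s F x z r s).
    apply: eq_bigr => x _; apply: eq_bigr => z _.
    by rewrite ent_mkop hB hA big_distrlr.
  transitivity (\sum_r \sum_s \sum_x \sum_z F x z r s); last first.
    rewrite pair_bigA /=; apply: eq_bigr => -[r s] _.
    rewrite /D /= rmorph_sum big_distrlr /=.
    apply: eq_bigr => x _; apply: eq_bigr => z _.
    by rewrite /F rmorphM /= mulrACA.
  under eq_bigr => x _ do rewrite exchange_big /=.
  rewrite exchange_big /=; apply: eq_bigr => r _.
  under eq_bigr => x _ do rewrite exchange_big /=.
  by rewrite exchange_big.
- move=> Y; rewrite !tr_ent; under eq_bigr => f _ do rewrite ent_mkop.
  rewrite exchange_big /=; apply: eq_bigr => x _.
  rewrite exchange_big /= -[RHS](sum_delta (fun z => ent Y x z)).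
  by apply: eq_bigr => z _; rewrite -mulr_suml trJ eq_sym.
Qed.

Lemma choi_trace L a b : trace_preserving L ->
  \sum_f ent (choi L) (a, f) (b, f) = (a == b)%:R.
Proof.
move=> tpL; under eq_bigr => f _ do rewrite ent_mkop /=.
rewrite -tr_ent tpL tr_ent; under eq_bigr => x _ do rewrite ent_mkop -mulnb natrM.
by rewrite sum_delta.
Qed.

End Choi.

(** * Symmetrization over the outputs *)

Section Permutations.
Variable R : realType.
Local Notation C := (R[i]).
Variables (I : finType) (n : nat).
Local Notation joint := (I * multi I n)%type.

Definition permute (pi : 'S_n) (f : multi I n) : multi I n := [ffun k => f (pi k)].

Definition permute_joint (pi : 'S_n) (p : joint) : joint := (p.1, permute pi p.2).

Definition permuted (T : finType) (phi : T -> T) (M : op R T) : op R T :=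
  mkop (fun x y => ent M (phi x) (phi y)).

Definition symmetrize (J : op R joint) : op R joint :=
  (n`!%:R)^-1 *: \sum_(pi : 'S_n) permuted (permute_joint pi) J.

Lemma fact_neq0 : n`!%:R != 0 :> C.
Proof. by rewrite pnatr_eq0 -lt0n fact_gt0. Qed.

Lemma permuteM pi tau f : permute pi (permute tau f) = permute (pi * tau)%g f.
Proof. by apply/ffunP => k; rewrite !ffunE permM. Qed.

Lemma permuteK pi : cancel (permute pi) (permute pi^-1%g).
Proof. by move=> f; apply/ffunP => k; rewrite !ffunE permKV. Qed.

Lemma permute_inj pi : injective (permute pi).
Proof. exact: can_inj (permuteK pi). Qed.

(** Inverting [x = y o pi^-1] to [y = x o pi] locates the single one in each row, so conjugation by
    [Wperm] becomes a relabelling of both indices. *)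
Lemma ent_Wperm pi (p q : joint) :
  ent (Wperm R I pi) p q = (q == permute_joint pi p)%:R.
Proof.
case: p q => [x f] [y g]; rewrite ent_mkop /= /permute_joint xpair_eqE /=.
rewrite [y == x]eq_sym; congr ((_ && _)%:R).
apply/eqP/eqP => [->|->]; apply/ffunP => k; rewrite !ffunE.
  by rewrite permK.
by rewrite permKV.
Qed.

Lemma Wperm_conj pi (J : op R joint) :
  Wperm R I pi *m J *m adj (Wperm R I pi) = permuted (permute_joint pi) J.
Proof.
apply: op_ext => p q; rewrite ent_mul ent_mkop.
under eq_bigr => r _ do rewrite ent_adj ent_Wperm conjC_nat mulrC.
rewrite sum_delta ent_mul.
by under eq_bigr => r _ do rewrite ent_Wperm; rewrite sum_delta.
Qed.

Lemma sym_invariantE (J : op R joint) : sym_invariant J <-> J = symmetrize J.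
Proof.
rewrite /sym_invariant /symmetrize.
by under eq_bigr => pi _ do rewrite Wperm_conj.
Qed.

(** Right translation by [tau] merely reindexes the sum over the group. *)
Lemma permuted_symmetrize tau (J : op R joint) :
  permuted (permute_joint tau) (symmetrize J) = symmetrize J.
Proof.
apply: op_ext => p q; rewrite ent_mkop !entZ !ent_sum; congr (_ * _).
rewrite [RHS](reindex_inj (mulIg tau)) /=; apply: eq_bigr => pi _.
by rewrite !ent_mkop /permute_joint /= !permuteM.
Qed.

Lemma symmetrize_invariant (J : op R joint) : sym_invariant (symmetrize J).
Proof.
apply/sym_invariantE; rewrite [RHS]/symmetrize.
under [X in _ = _ *: X]eq_bigr => pi _ do rewrite permuted_symmetrize.
rewrite sumr_const card_Sn -[X in _ *: X]scaler_nat scalerA mulVf ?scale1r //.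
exact: fact_neq0.
Qed.

Lemma psd_symmetrize (J : op R joint) : psd J -> psd (symmetrize J).
Proof.
move=> pJ; apply: psdZ; first by rewrite invr_ge0 ler0n.
by apply: psd_sum => pi _; exact: psd_pullback.
Qed.

Lemma ptr_out_symmetrize (J : op R joint) : ptr_out (symmetrize J) = ptr_out J.
Proof.
apply: op_ext => a b; rewrite !ent_mkop.
under eq_bigr => f _ do rewrite entZ ent_sum.
rewrite -mulr_sumr exchange_big /=.
under eq_bigr => pi _ do
  (under eq_bigr => f _ do rewrite ent_mkop /permute_joint /=).
under eq_bigr => pi _ do
  rewrite -(reindex_inj (h := permute pi) (P := xpredT)
     (F := fun f => ent J (a, f) (b, f)) (@permute_inj pi)).
by rewrite sumr_const card_Sn -[X in _ * X]mulr_natl mulKf // fact_neq0.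
Qed.

Lemma ptr_keep_permuted (pi : 'S_n) j (M : op R (multi I n)) :
  ptr_keep (pi j) (permuted (permute pi) M) = ptr_keep j M.
Proof.
apply: op_ext => a b; rewrite !ent_mkop [RHS](reindex_inj (@permute_inj pi)).
apply: eq_big => [f|f _]; rewrite ?ffunE // ent_mkop; congr ent.
by apply/ffunP => k; rewrite !ffunE (inj_eq perm_inj).
Qed.

Lemma ptr_keep_scale_sum (T : finType) j c (M : T -> op R (multi I n)) :
  ptr_keep j (c *: \sum_t M t) = c *: \sum_t ptr_keep j (M t).
Proof.
apply: op_ext => a b; rewrite entZ ent_sum ent_mkop.
under [in RHS]eq_bigr => t _ do rewrite ent_mkop.
rewrite [in RHS]exchange_big mulr_sumr /=.
by apply: eq_bigr => f _; rewrite entZ ent_sum.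
Qed.

Lemma upd_id (f : multi I n) j : upd f j (f j) = f.
Proof. by apply/ffunP => k; rewrite ffunE; case: eqP => [->|]. Qed.

Lemma upd_upd (f : multi I n) j a b : upd (upd f j a) j b = upd f j b.
Proof. by apply/ffunP => k; rewrite !ffunE; case: eqP. Qed.

(** Tuples with coordinate [j] frozen at [x0] enumerate the traced-out systems. The partial trace
    thereby becomes a sum of pullbacks, which shows its positivity. *)
Lemma ptr_keepE x0 j (M : op R (multi I n)) :
  ptr_keep j M =
  \sum_(h : multi I n | h j == x0) mkop (fun a b => ent M (upd h j a) (upd h j b)).
Proof.
apply: op_ext => a b; rewrite ent_mkop ent_sum.
rewrite (reindex_onto (fun h => upd h j a) (fun f => upd f j x0)) => [|f /eqP <-]; last first.
  by rewrite upd_upd upd_id.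
apply: eq_big => [h|h _]; last by rewrite ent_mkop upd_upd.
rewrite upd_upd !ffunE !eqxx /=.
apply/eqP/eqP => [<-|<-]; last by rewrite upd_id.
by rewrite ffunE eqxx.
Qed.

Lemma psd_ptr_keep j (M : op R (multi I n)) : psd M -> psd (ptr_keep j M).
Proof.
(* The reference value [x0] exists unless [I] is empty, in which case the marginal is a matrix of
   size zero. *)
move=> pM; case: (pickP (@predT I)) => [x0 _|I0]; last first.
  have -> : ptr_keep j M = 0 by apply: op_ext => a; have := I0 a.
  exact: psd0.
rewrite (ptr_keepE x0); apply: psd_sum => h _; exact: psd_pullback.
Qed.

Lemma choi_map_permuted pi (J : op R joint) (Y : op R I) :
  choi_map (permuted (permute_joint pi) J) Y =
  permuted (permute pi) (choi_map J Y).
Proof.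
apply: op_ext => f g; rewrite !ent_mkop.
by apply: eq_bigr => x _; apply: eq_bigr => z _; rewrite ent_mkop.
Qed.

Lemma choi_map_symmetrize (J : op R joint) (Y : op R I) :
  choi_map (symmetrize J) Y =
  (n`!%:R)^-1 *: \sum_(pi : 'S_n) permuted (permute pi) (choi_map J Y).
Proof.
apply: op_ext => f g; rewrite ent_mkop entZ ent_sum.
under [in RHS]eq_bigr => pi _ do rewrite -choi_map_permuted ent_mkop.
rewrite mulr_sumr.
under [RHS]eq_bigr => pi _ do (rewrite mulr_sumr;
  under eq_bigr => x _ do rewrite mulr_sumr).
rewrite [RHS]exchange_big /=; apply: eq_bigr => x _.
rewrite [RHS]exchange_big /=; apply: eq_bigr => z _.
by rewrite entZ ent_sum mulr_sumr mulr_suml; apply: eq_bigr => pi _; rewrite mulrA.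
Qed.

(** The transposition of [j] and [k] exchanges the two marginals and fixes an invariant [J]. *)
Lemma ptr_keep_invariant (J : op R joint) (Y : op R I) j k : sym_invariant J ->
  ptr_keep j (choi_map J Y) = ptr_keep k (choi_map J Y).
Proof.
move=> /sym_invariantE eJ.
rewrite -(ptr_keep_permuted (tperm j k) j (choi_map J Y)) tpermL.
by rewrite -choi_map_permuted {1}eJ permuted_symmetrize -eJ.
Qed.

Lemma ptr_keep_symmetrize (J : op R joint) (Y : op R I) j : (0 < n)%N ->
  ptr_keep j (choi_map (symmetrize J) Y) =
  n%:R^-1 *: \sum_k ptr_keep k (choi_map J Y).
Proof.
move=> n0; have nz : n%:R != 0 :> C by rewrite pnatr_eq0 -lt0n.
apply: (scalerI nz); rewrite scalerA mulfV // scale1r.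
(* The marginals of the symmetrized map coincide, so [n] times one of them is their sum; each [pi]
   only reorders the terms of that sum. *)
have -> : n%:R *: ptr_keep j (choi_map (symmetrize J) Y) =
    \sum_(k < n) ptr_keep k (choi_map (symmetrize J) Y).
  rewrite (eq_bigr (fun=> ptr_keep j (choi_map (symmetrize J) Y))) => [|k _].
    by rewrite sumr_const card_ord scaler_nat.
  exact/ptr_keep_invariant/symmetrize_invariant.
under eq_bigr => k _ do rewrite choi_map_symmetrize ptr_keep_scale_sum.
rewrite -scaler_sumr exchange_big /=.
under eq_bigr => pi _ do (rewrite (reindex_inj (@perm_inj _ pi)) /=;
  under eq_bigr => k _ do rewrite ptr_keep_permuted).
by rewrite sumr_const card_Sn -[X in _ *: X]scaler_nat scalerA mulVf ?scale1r // fact_neq0.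
Qed.

(** Identifies the lower right block of the program's constraint with the first marginal of the
    channel of [J]. *)
Lemma ptr_keep1E (j : 'I_n) (J : op R joint) (rho : op R I) : j = 0%N :> nat ->
  ptr_keep1 (J *m tens_id n rho^T) = ptr_keep j (choi_map J rho).
Proof.
move=> j0; rewrite /ptr_keep1.
have -> : insub 0%N = Some j by rewrite -j0; exact: valK.
apply: op_ext => a b; rewrite !ent_mkop exchange_big /=.
apply: eq_bigr => f _; rewrite ent_mkop; apply: eq_bigr => x _.
transitivity (\sum_z \sum_g ent J (x, f) (z, g) *
    ent (tens_id n rho^T) (z, g) (x, upd f j b)).
  by rewrite ent_mul pair_bigA; apply: eq_bigr => -[].
apply: eq_bigr => z _.
under eq_bigr => g _ do rewrite ent_mkop /= ent_tr mulrA mulrC.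
by rewrite sum_delta.
Qed.

End Permutations.

(** * Comparison of the two sets of values *)

Section Value.
Variable R : realType.
Local Notation C := (R[i]).

(** Mutual domination gives equal sets of upper bounds and simultaneous emptiness, and [sup] is
    determined by these two data. *)
Lemma sup_eq_dominated (E F : set R) :
  (forall x, E x -> exists2 y, F y & x <= y) ->
  (forall y, F y -> exists2 x, E x & y <= x) -> sup E = sup F.
Proof.
move=> EF FE.
have ubE : ubound E = ubound F.
  apply/seteqP; split=> u uE z.
    by move=> /FE[x Ex zx]; exact: le_trans zx (uE x Ex).
  by move=> /EF[y Fy zy]; exact: le_trans zy (uE y Fy).
have E0 : (E == set0) = (F == set0).
  apply/eqP/eqP => [E0|F0]; apply/seteqP; split=> // z.
    by move=> /FE[x]; rewrite E0.
  by move=> /EF[y]; rewrite F0.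
by rewrite /sup /supremum E0 /supremums ubE.
Qed.

Lemma cRe_sum (T : finType) (F : T -> C) :
  @complex.Re R (\sum_t F t) = \sum_t complex.Re (F t).
Proof. by apply: (big_morph _ (@cReD R)). Qed.

Lemma cReZ (a : R) (z : C) : @complex.Re R ((a%:C)%C * z) = a * complex.Re z.
Proof. by case: z => x y /=; rewrite mul0r subr0. Qed.

Lemma sdp_objectiveE (I : finType) m (p : 'I_m -> R) (X : 'I_m -> op R I) :
  sdp_objective p X = \sum_i p i * complex.Re (\tr (X i)).
Proof.
rewrite /sdp_objective cRe_sum; apply: eq_bigr => i _.
have -> : 2%:R^-1 = ((2%:R^-1 : R)%:C)%C :> C by rewrite fmorphV rmorph_nat.
rewrite -mulrA !cReZ mxtraceD tr_adj cReD cRe_conj.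
move: (complex.Re _) => z; lra.
Qed.

(** The block matrices share their upper left corner, so their mean keeps [rho] there and averages
    the other blocks. *)
Lemma block_avg k n (rho : 'M[C]_k) (X S : 'I_n -> 'M[C]_k) : (0 < n)%N ->
  (forall j, psd (block_mx rho (X j) (adj (X j)) (S j))) ->
  psd (block_mx rho (n%:R^-1 *: \sum_j X j) (adj (n%:R^-1 *: \sum_j X j))
         (n%:R^-1 *: \sum_j S j)).
Proof.
move=> n0 h; have nz : n%:R != 0 :> C by rewrite pnatr_eq0 -lt0n.
have -> : block_mx rho (n%:R^-1 *: \sum_j X j) (adj (n%:R^-1 *: \sum_j X j))
         (n%:R^-1 *: \sum_j S j) =
    n%:R^-1 *: \sum_j block_mx rho (X j) (adj (X j)) (S j).
  have -> : \sum_j block_mx rho (X j) (adj (X j)) (S j) =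
      block_mx (\sum_(j < n) rho) (\sum_j X j) (\sum_j adj (X j)) (\sum_j S j).
    apply/matrixP => a b; rewrite summxE.
    case: (split_ordP a) => a' ->; case: (split_ordP b) => b' ->;
      rewrite ?block_mxEul ?block_mxEur ?block_mxEdl ?block_mxEdr summxE;
      apply: eq_bigr => j _;
      by rewrite ?block_mxEul ?block_mxEur ?block_mxEdl ?block_mxEdr.
  rewrite scale_block_mx sumr_const card_ord -[rho *+ n]scaler_nat.
  rewrite scalerA mulVf // scale1r adj_scale adj_sum geC0_conj //.
  by rewrite invr_ge0 ler0n.
by apply: psdZ; [rewrite invr_ge0 ler0n|exact: psd_sum].
Qed.

End Value.

Theorem theorem5 (R : realType) (I : finType) (m n : nat)
  (p : 'I_m -> R) (rho : 'I_m -> op R I) :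
  (0 < n)%N ->
  (forall i, 0 <= p i) -> \sum_(i < m) p i = 1 ->
  (forall i, is_state (rho i)) ->
  g_n n p rho = sdp_value n p rho.
Proof.
move=> n0 p_ge0 _ rho_state; pose j0 : 'I_n := Ordinal n0.
have nz : n%:R != 0 :> R by rewrite pnatr_eq0 -lt0n.
apply: sup_eq_dominated => v.
- move=> [L [[linL cpL tpL] ->]].
  pose sigma i j := ptr_keep j (L (rho i)).
  have psig i j : psd (sigma i j).
    exact/psd_ptr_keep/(positive_of_cp cpL)/(rho_state i).1.
  have exX i j : exists X : op R I,
      psd (block_mx (rho i) X (adj X) (sigma i j)) /\
      complex.Re (\tr X) = fidelity (rho i) (sigma i j).
    by have [X ? ?] := fidelity_attained (rho_state i).1 (psig i j); exists X.
  have [X hX] := fin_all_exists (fun i => fin_all_exists (exX i)).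
  (* Symmetrizing the Choi matrix averages the marginals over [j]; averaging the optimal [X i j] in
     the same way preserves the block constraint. *)
  pose Xa i := (n%:R : R[i])^-1 *: \sum_j X i j.
  exists (sdp_objective p Xa).
    exists Xa, (symmetrize (choi L)); split=> //.
    have pJ : psd (symmetrize (choi L)) by apply/psd_symmetrize/psd_choi.
    split=> //.
    + move=> i; rewrite (ptr_keep1E (j := j0)) // ptr_keep_symmetrize //.
      by rewrite choi_mapK //; apply: block_avg => // j; have [] := hX i j.
    + exact: pJ.1.
    + rewrite ptr_out_symmetrize; apply: op_ext => a b.
      by rewrite ent_mkop choi_trace // ent1.
    + exact: symmetrize_invariant.
  rewrite sdp_objectiveE; apply: ler_sum => i _.
  have -> : \tr (Xa i) = ((n%:R^-1 : R)%:C)%C * \sum_j \tr (X i j).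
    rewrite /Xa mxtraceZ fmorphV rmorph_nat; congr (_ * _).
    exact: (raddf_sum (@mxtrace _ _)).
  rewrite cReZ cRe_sum mulrA mulr_sumr; apply: ler_sum => j _.
  by have [_ ->] := hX i j; rewrite [p i * _]mulrC.
- move=> [X [J [[hX _ pJ trJ symJ] ->]]].
  exists (\sum_(i < m) \sum_(j < n) n%:R^-1 * p i *
           fidelity (rho i) (ptr_keep j (choi_map J (rho i)))).
    exists (choi_map J); split=> //; apply: choi_map_channel => // a b.
    by have := congr1 (fun M => ent M a b) trJ; rewrite ent_mkop ent1.
  rewrite sdp_objectiveE; apply: ler_sum => i _.
  (* By symmetry of [J] all outputs have the marginal of output [j0], the one in the block
     constraint, so the [n] equal terms cancel the weight [n%:R^-1]. *)
  rewrite (eq_bigr (fun=> n%:R^-1 * p i *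
      fidelity (rho i) (ptr_keep j0 (choi_map J (rho i))))) => [|j _]; last first.
    by rewrite (ptr_keep_invariant _ j j0 symJ).
  rewrite sumr_const card_ord -[X in _ <= X]mulr_natl !mulrA mulfV // mul1r.
  apply: ler_wpM2l => //; apply: fidelity_ge.
  by rewrite -ptr_keep1E.
Qed.
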